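(* The limiting density of the residues attained by the Fibonacci sequence modulo powers of $2$ is $$\operatorname{dens}(2) = \lim_{\lambda\to\infty} \frac{\lvert\{F(n) \bmod 2^\lambda : n \ge 0\}\rvert}{2^\lambda} = \frac{21}{32}.$$
   Context: $F(n)_{n\ge 0}$ is the Fibonacci sequence: $F(0)=0$, $F(1)=1$, $F(n+2)=F(n+1)+F(n)$. *)

(* Defs.v *)
From HB Require Import structures.
From mathcomp Require Import all_boot all_order all_algebra.
From mathcomp Require Import all_classical all_reals all_analysis.
Set Implicit Arguments.
Unset Strict Implicit.
Unset Printing Implicit Defensive.
Import Order.TTheory GRing.Theory Num.Theory.
Import numFieldNormedType.Exports.
Local Open Scope classical_set_scope.
Local Open Scope ring_scope.

Fixpoint fib (n : nat) : nat :=
  match n with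
  | 0 => 0
  | 1 => 1
  | (m.+1 as k).+1 => fib k + fib m
  end%N.

(* For m > 0 the ordinals below m are exactly the possible values of
   _ %% m, so no residue is lost by counting inside 'I_m. *)
Definition attained_residues (m : nat) : {set 'I_m} :=
  finset (fun r : 'I_m => `[< exists n : nat, (fib n %% m)%N = r >]).

Definition residue_density (R : realType) (p l : nat) : R :=
  #|attained_residues (p ^ l)|%:R / (p ^ l)%:R.

(* limn returns an unspecified value on a divergent sequence, so an equation
   about dens is meaningful only together with convergence. *)
Definition dens (R : realType) (p : nat) : R :=
  limn (residue_density R p).

(* Main.v *)
Require Import Defs.
From HB Require Import structures.
From mathcomp Require Import all_boot all_order all_algebra.
From mathcomp Require Import all_classical all_reals all_analysis.
From mathcomp Require Import ring zify.
Import Order.TTheory GRing.Theory Num.Theory.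
Import numFieldNormedType.Exports.
Local Open Scope classical_set_scope.
Local Open Scope ring_scope.

(** For l >= 5 the attained residues modulo 2^l are exactly those that are odd,
    divisible by 8, or congruent to 2 modulo 32; these form a proportion 21/32.
    No other residue occurs because F has period 48 modulo 32.  Conversely,
    with p = 6 * 2^t one has F(p) = 2^(t+3) * odd and
    F(p+1) = 1 + 2^(t+2) * odd, so that
    - shifting the index by p changes an odd F(n) by 2^(t+2) * odd and an F(n)
      divisible by 8 by 2^(t+3) * odd;
    - shifting it by 2p when n = 3 modulo 12 changes F(n) by
      F(p) L(n+p) = 2^(t+5) * odd.
    A residue attained modulo a power of 2 can therefore be corrected one
    binary digit at a time. *)

Lemma fib_add m n :
  fib (m + n).+1 = (fib m * fib n + fib m.+1 * fib n.+1)%N.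
Proof.
elim: m n => [|m IHm] n; first by rewrite /= mul0n mul1n.
have fibSS k : fib k.+2 = (fib k.+1 + fib k)%N by [].
by rewrite addSnnS IHm !fibSS; ring.
Qed.

Definition consecutive_fib (u v : int) : Prop :=
  exists n, u = (fib n)%:Z /\ v = (fib n.+1)%:Z.

(** If [x] and [y] have indices p and p + 1, then [y - x] is F(p-1), with F(-1) = 1, so this is the
    index addition formula for pairs, valid also at p = 0. *)
Lemma consecutive_fib_add u v x y :
  consecutive_fib u v -> consecutive_fib x y ->
  consecutive_fib (u * (y - x) + v * x) (u * x + v * y).
Proof.
move=> [n [-> ->]] [p [-> ->]]; exists (n + p)%N.
rewrite fib_add; split; last by rewrite PoszD !PoszM.
case: n => [|n]; first by rewrite add0n /=; ring.
have fibSS k : fib k.+2 = (fib k.+1 + fib k)%N by [].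
by rewrite addSn fib_add fibSS !PoszD !PoszM; ring.
Qed.

(* The witness is the pair at index 6 * 2^t; the last conjunct is Cassini's
   identity at an even index, and all three claims survive index doubling. *)
Lemma consecutive_fib_doubling t : exists x y a b : int,
  [/\ consecutive_fib x y,
      x = 8 * 2 ^+ t * (2 * a + 1),
      y = 1 + 4 * 2 ^+ t * (2 * b + 1) &
      y ^+ 2 = 1 + x * y + x ^+ 2].
Proof.
elim: t => [|t [x [y [a [b [cxy ex ey cassini]]]]]].
  by exists 8, 13, 0, 1; split=> //; exists 6%N.
set X : int := 2 ^+ t in ex ey.
exists (x * (y - x) + y * x), (x * x + y * y).
exists (a + (2 * a + 1) * 4 * X * (b - a)).
exists (b + 4 * X * (2 * a + 1) ^+ 2 + X * (2 * b + 1) ^+ 2).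
split; first exact: consecutive_fib_add.
- by rewrite ex ey exprS -/X; ring.
- by rewrite ex ey exprS -/X; ring.
(* The form y^2 - xy - x^2 is a multiplicative norm, so doubling the index squares its value. *)
- have cassini2 : (y ^+ 2 - x * y - x ^+ 2) ^+ 2 = 1 by rewrite cassini; ring.
  by apply/eqP; rewrite -subr_eq0; apply/eqP; rewrite -[RHS](subrr 1)
    -[X in _ = X - _]cassini2; ring.
Qed.

(** Induction on [t]: an even error [k] is halved, while an odd one is first made even by [lift],
    which adds an odd multiple of [M * 2 ^+ t]. [Inv] is what a seed must satisfy for [lift] to stay
    applicable. *)
Lemma residue_lifting (Inv : int -> int -> Prop) (M u0 v0 : int) :
  consecutive_fib u0 v0 -> Inv u0 v0 ->
  (forall t u v, consecutive_fib u v -> Inv u v ->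
     exists u' v' e, [/\ consecutive_fib u' v', Inv u' v' &
                         v' = v + M * 2 ^+ t * (2 * e + 1)]) ->
  forall t q, exists u v k,
    consecutive_fib u v /\ v = v0 + M * q + M * 2 ^+ t * k.
Proof.
move=> c0 I0 lift t q.
suff [u [v [k [? ? ?]]]] : exists u v k, [/\ consecutive_fib u v, Inv u v &
    v = v0 + M * q + M * 2 ^+ t * k] by exists u, v, k.
elim: t => [|t [u [v [k [cuv Iuv ev]]]]].
  by exists u0, v0, (- q); split=> //; ring.
have [[j ej]|[j ej]] : (exists j, k = 2 * j) \/ (exists j, k = 2 * j + 1).
  by have [h|h] : (k %% 2)%Z = 0 \/ (k %% 2)%Z = 1; [lia|left|right];
    exists (k %/ 2)%Z; lia.
- by exists u, v, j; split=> //; rewrite ev ej exprS; ring.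
have [u' [v' [e [cuv' Iuv' ev']]]] := lift t u v cuv Iuv.
by exists u', v', (j + e + 1); split=> //; rewrite ev' ev ej exprS; ring.
Qed.

Lemma odd_lifting t u v : consecutive_fib u v -> (exists w, v = 2 * w + 1) ->
  exists u' v' e, [/\ consecutive_fib u' v', (exists w, v' = 2 * w + 1) &
    v' = v + 4 * 2 ^+ t * (2 * e + 1)].
Proof.
move=> cuv [w ev]; have [x [y [a [b [cxy ex ey _]]]]] := consecutive_fib_doubling t.
set X : int := 2 ^+ t in ex ey *.
exists (u * (y - x) + v * x), (u * x + v * y).
exists (u * (2 * a + 1) + w + 2 * w * b + b); split.
- exact: consecutive_fib_add.
- exists (4 * X * u * (2 * a + 1) + w + 2 * X * (2 * w + 1) * (2 * b + 1)).
  by rewrite ex ey ev; ring.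
- by rewrite ex ey ev; ring.
Qed.

(** The shift adds [u * x + v * (y - 1)]. Its second term is divisible by [32 * 2 ^+ t], so the
    oddness of [u] makes the change exactly [8 * 2 ^+ t] times an odd number. *)
Lemma mul8_lifting t u v : consecutive_fib u v ->
  (exists s w, u = 2 * s + 1 /\ v = 8 * w) ->
  exists u' v' e, [/\ consecutive_fib u' v',
    (exists s w, u' = 2 * s + 1 /\ v' = 8 * w) &
    v' = v + 8 * 2 ^+ t * (2 * e + 1)].
Proof.
move=> cuv [s [w [eu ev]]].
have [x [y [a [b [cxy ex ey _]]]]] := consecutive_fib_doubling t.
set X : int := 2 ^+ t in ex ey *.
exists (u * (y - x) + v * x), (u * x + v * y).
exists (2 * s * a + s + a + 2 * w * (2 * b + 1)); split.
- exact: consecutive_fib_add.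
- exists (s + (2 * s + 1) * (2 * X * (2 * b + 1) - 4 * X * (2 * a + 1)) + 4 * w * x).
  exists (u * X * (2 * a + 1) + w * y).
  by split; [rewrite ex ey eu ev | rewrite ex ev]; ring.
- by rewrite ex ey eu ev; ring.
Qed.

(* [2 * u + v] is the Lucas number at the index of [v].  Two shifts by the
   same even index p give F(n + 2p) - F(n) = F(p) L(n + p). *)
Lemma lucas4_lifting t u v : consecutive_fib u v ->
  (exists c, 2 * u + v = 8 * c + 4) ->
  exists u' v' e, [/\ consecutive_fib u' v',
    (exists c, 2 * u' + v' = 8 * c + 4) &
    v' = v + 32 * 2 ^+ t * (2 * e + 1)].
Proof.
have shift (u1 v1 x y X a b : int) : x = 8 * X * (2 * a + 1) ->
    y = 1 + 4 * X * (2 * b + 1) -> (exists c, 2 * u1 + v1 = 8 * c + 4) ->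
    exists c, 2 * (u1 * (y - x) + v1 * x) + (u1 * x + v1 * y) = 8 * c + 4.
  move=> ex ey [c ec].
  exists (c * y + 2 * X * (2 * b + 1) + X * (2 * a + 1) * (2 * v1 - u1)).
  have -> : v1 = 8 * c + 4 - 2 * u1 by rewrite -ec; ring.
  by rewrite ex ey; ring.
move=> cuv luc.
have [x [y [a [b [cxy ex ey cassini]]]]] := consecutive_fib_doubling t.
have luc1 := shift _ _ _ _ _ _ _ ex ey luc.
have cuv1 := consecutive_fib_add _ _ _ _ cuv cxy.
have luc2 := shift _ _ _ _ _ _ _ ex ey luc1.
have cuv2 := consecutive_fib_add _ _ _ _ cuv1 cxy.
set u1 := u * (y - x) + v * x in luc1 cuv1 luc2 cuv2.
set v1 := u * x + v * y in luc1 cuv1 luc2 cuv2.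
case: luc1 => c ec.
exists (u1 * (y - x) + v1 * x), (u1 * x + v1 * y), (2 * a * c + a + c).
split=> //.
have -> : u1 * x + v1 * y = v + x * (2 * u1 + v1).
  apply/eqP; rewrite -subr_eq0; apply/eqP.
  have -> : u1 * x + v1 * y - (v + x * (2 * u1 + v1))
     = v * (y ^+ 2 - (1 + x * y + x ^+ 2)) by rewrite /u1 /v1; ring.
  by rewrite cassini; ring.
by rewrite ec ex; ring.
Qed.

Definition fib_residue (r : nat) : bool :=
  [|| odd r, (8 %| r)%N | (r %% 32 == 2)%N].

Lemma fib_residue_mod32 r : fib_residue (r %% 32) = fib_residue r.
Proof. by rewrite /fib_residue; lia. Qed.

Lemma fib_residue_fib n : fib_residue (fib n).
Proof.
(* Iterating on pairs reduced modulo 32 keeps the check over one period of 48 computable. *)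
pose step (z : nat * nat) := (z.2, (z.1 + z.2) %% 32)%N.
have stepE k : iter k step (0, 1)%N = (fib k %% 32, fib k.+1 %% 32)%N.
  elim: k => //= k ->; rewrite /step /= modnDm; congr (_, _ %% _)%N.
  exact: addnC.
have iter48 k : iter (k * 48) step (0, 1)%N = (0, 1)%N.
  elim: k => // k IHk; rewrite mulSn addnC iterD.
  by have -> : iter 48 step (0, 1)%N = (0, 1)%N by vm_compute.
have : fib_residue (iter (n %% 48) step (0, 1)%N).1.
  have /allP : all (fun k => fib_residue (iter k step (0, 1)%N).1) (iota 0 48).
    by vm_compute.
  by apply; rewrite mem_iota /= add0n ltn_mod.
have -> : iter (n %% 48) step (0, 1)%N = iter n step (0, 1)%N.
  by rewrite [in RHS](divn_eq n 48) addnC iterD iter48.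
by rewrite stepE fib_residue_mod32.
Qed.

Lemma fib_residue_attained k r : (r < 2 ^ (k + 5))%N -> fib_residue r ->
  exists n, (fib n %% 2 ^ (k + 5))%N = r.
Proof.
move=> ltr fr.
suff [u [v [j [[n [_ ev]] ej]]]] : exists u v j : int,
    consecutive_fib u v /\ v = r%:Z + (2 ^ (k + 5))%:Z * j.
  exists n.+1; rewrite -[RHS](modn_small ltr).
  have : (v %% (2 ^ (k + 5))%:Z)%Z = (r%:Z %% (2 ^ (k + 5))%:Z)%Z.
    by rewrite ej mulrC addrC modzMDl.
  by rewrite ev !modz_nat => -[].
have pow2 i : (2 ^ i)%:Z = 2 ^+ i :> int by rewrite -natrX natz.
have [q [odd_r|[e8|e32]]] : exists q : int,
    (r%:Z = 1 + 4 * q \/ r%:Z = 3 + 4 * q) \/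
    r%:Z = 0 + 8 * q \/ r%:Z = 2 + 32 * q.
  (* One seed per class: F(1) = 1, F(4) = 3, F(6) = 8 and F(3) = 2. The odd residues split in two
     because their lifting starts at modulus 4. *)
  have [h|[h|[h|h]]] : (r %% 4 = 1 \/ r %% 4 = 3 \/ r %% 8 = 0 \/ r %% 32 = 2)%N.
  - by move: fr; rewrite /fib_residue; lia.
  - by exists (r %/ 4)%N%:Z; lia.
  - by exists (r %/ 4)%N%:Z; lia.
  - by exists (r %/ 8)%N%:Z; lia.
  - by exists (r %/ 32)%N%:Z; lia.
- have c01 : consecutive_fib 0 1 by exists 0%N.
  have c23 : consecutive_fib 2 3 by exists 3%N.
  have o1 : exists w : int, 1 = 2 * w + 1 by exists 0.
  have o3 : exists w : int, 3 = 2 * w + 1 by exists 1.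
  case: odd_r => e4.
  + have [u [v [j [cuv ev]]]] := residue_lifting _ _ _ _ c01 o1 odd_lifting (k + 3)%N q.
    exists u, v, j; split=> //.
    by rewrite ev e4 pow2 !exprD; ring.
  + have [u [v [j [cuv ev]]]] := residue_lifting _ _ _ _ c23 o3 odd_lifting (k + 3)%N q.
    exists u, v, j; split=> //.
    by rewrite ev e4 pow2 !exprD; ring.
- have c58 : consecutive_fib 5 8 by exists 5%N.
  have I58 : exists s w : int, 5 = 2 * s + 1 /\ 8 = 8 * w by exists 2, 1.
  (* The seed is 8 since 0 is never the second entry of a pair; hence [q - 1]. *)
  have [u [v [j [cuv ev]]]] :=
    residue_lifting _ _ _ _ c58 I58 mul8_lifting (k + 2)%N (q - 1).
  exists u, v, j; split=> //.
  by rewrite ev e8 pow2 !exprD; ring.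
- have c12 : consecutive_fib 1 2 by exists 2%N.
  have I12 : exists c : int, 2 * 1 + 2 = 8 * c + 4 by exists 0.
  have [u [v [j [cuv ev]]]] :=
    residue_lifting _ _ _ _ c12 I12 lucas4_lifting k q.
  exists u, v, j; split=> //.
  by rewrite ev e32 pow2 !exprD; ring.
Qed.

(** Each block of 32 contains 16 odd numbers, 4 multiples of 8 and one number congruent to 2. *)
Lemma count_fib_residue m : count fib_residue (iota 0 (m * 32)) = (m * 21)%N.
Proof.
elim: m => // m IHm.
rewrite mulSn addnC iotaD count_cat IHm add0n -[X in iota X]addn0 iotaDl.
rewrite count_map (eq_count (a2 := fib_residue)).
  have -> : count fib_residue (iota 0 32) = 21%N by vm_compute.
  by rewrite mulSn addnC.
by move=> i /=; rewrite -fib_residue_mod32 modnMDl fib_residue_mod32.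
Qed.

Lemma card_attained_residues k :
  #|attained_residues (2 ^ (k + 5))| = (2 ^ k * 21)%N.
Proof.
have -> : attained_residues (2 ^ (k + 5))
    = finset (fun r : 'I_(2 ^ (k + 5)) => fib_residue r).
  apply/setP => r; rewrite !inE; apply/asboolP/idP => [[n <-]|fr].
    rewrite -fib_residue_mod32 modn_dvdm ?fib_residue_mod32 ?fib_residue_fib //.
    by rewrite (dvdn_exp2l 2 (leq_addl k 5)).
  exact: fib_residue_attained.
rewrite cardsE cardE /enum_mem -enumT size_filter /=.
rewrite -count_fib_residue -val_enum_ord expnD count_map.
by [].
Qed.

Theorem theorem6 (R : realType) :
  cvgn (residue_density R 2) /\ dens R 2 = 21%:R / 32%:R.
Proof.
have densE k : residue_density R 2 (k + 5) = 21%:R / 32%:R.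
  rewrite /residue_density card_attained_residues expnD !natrM.
  by rewrite -mulf_div divff ?mul1r // pnatr_eq0 expn_eq0.
suff lim_dens : residue_density R 2 @ \oo --> (21%:R / 32%:R : R).
  by split; [apply: cvgP lim_dens | apply: cvg_lim lim_dens].
apply: cvg_near_cst; exists 5%N => // n /= le5n.
by rewrite -(subnK le5n) densE.
Qed.
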